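(* Let $(\mathcal{E},\|\cdot\|)$ be a normed vector space, let $\mathcal{C}\subset\mathcal{E}$ be a bounded convex set with $\sup_{x,y\in\mathcal{C}}\|x-y\|\le D$, $0<D<\infty$, and let $T:\mathcal{C}\to\mathcal{C}$ be $\gamma$-Lipschitz. Let $\epsilon>0$ and $\beta\in(0,1)$, let $x_0\in\mathcal{C}$, and define $x_{k+1}=\lambda x_0+(1-\lambda)T(x_k)$ for $k\ge0$, where $\lambda=\frac{\beta\epsilon/D}{1+\beta\epsilon/D}$. If $0\le\gamma<1+\frac{\beta\epsilon}{D}$, then $\|T(x_k)-x_k\|\le\epsilon$ after at most $$k=\Big\lceil\frac{\ln\big(\|T(x_0)-x_0\|/((1-\beta)\epsilon)\big)}{-\ln((1-\lambda)\gamma)}\Big\rceil$$ iterations.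
   Context: $T$ is $\gamma$-Lipschitz on $\mathcal{C}$ if $\|T(x)-T(y)\|\le\gamma\|x-y\|$ for all $x,y\in\mathcal{C}$. A nonpositive (or $-\infty$) iteration count is read as $0$; when $\gamma=0$, where the displayed quotient is undefined, the count is read as $1$. *)

(* Defs.v *)
(* MathComp / MathComp-Analysis *)
From HB Require Import structures.
From mathcomp Require Import all_boot all_order all_algebra.
From mathcomp Require Import all_classical all_reals all_analysis.

Set Implicit Arguments.
Unset Strict Implicit.
Unset Printing Implicit Defensive.

Import Order.TTheory GRing.Theory Num.Theory.
Import numFieldNormedType.Exports.

Local Open Scope classical_set_scope.
Local Open Scope ring_scope.

Definition anchor_weight (R : realType) (beta eps D : R) : R :=
  (beta * eps / D) / (1 + beta * eps / D).

Fixpoint anchored_iter (R : realType) (E : normedModType R) (T : E -> E)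
    (lambda : R) (x0 : E) (k : nat) : E :=
  if k is k'.+1 then
    lambda *: x0 + (1 - lambda) *: T (anchored_iter T lambda x0 k')
  else x0.

(* ceil (ln (r0 / ((1 - beta) eps)) / - ln ((1 - lambda) gamma)), where r0 is
   the initial residual. Since the library sets ln 0 = 0, the two degenerate
   cases are explicit: the count is 1 if gamma = 0 (the denominator is
   undefined), and 0 if r0 = 0 (the numerator is -oo). Negative values are
   truncated to 0. *)
Definition iter_count (R : realType) (gamma lambda beta eps r0 : R) : nat :=
  if gamma == 0 then 1%N
  else if r0 == 0 then 0%N
  else `|(Num.max 0 (Num.ceil (ln (r0 / ((1 - beta) * eps)) /
                               - ln ((1 - lambda) * gamma))))%R|%N.

(* Main.v *)
Require Import Defs.
From HB Require Import structures.
From mathcomp Require Import all_boot all_order all_algebra.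
From mathcomp Require Import all_classical all_reals all_analysis.
From mathcomp Require Import ring lra.

Set Implicit Arguments.
Unset Strict Implicit.
Unset Printing Implicit Defensive.

Import Order.TTheory GRing.Theory Num.Theory.
Import numFieldNormedType.Exports.

Local Open Scope classical_set_scope.
Local Open Scope ring_scope.

(** Let q := (1 - lambda) gamma and r0 := |T x_0 - x_0|.  The iterates move
    geometrically: x_1 - x_0 = (1 - lambda) (T x_0 - x_0), and for k >= 1
    x_(k+1) - x_k = (1 - lambda) (T x_k - T x_(k-1)), so that
    |x_(k+1) - x_k| <= (1 - lambda) q^k r0 ([anchored_iter_step]).  On the
    other hand, for k >= 1, T x_k - x_k = lambda (T x_k - x_0) +
    (1 - lambda) (T x_k - T x_(k-1)), where the first term costs at most
    lambda D by the diameter bound and the second is at most q |x_k - x_(k-1)|;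
    hence |T x_k - x_k| <= lambda D + (1 - lambda) q^k r0
    ([anchored_iter_residual]).

    The weight lambda is chosen so that 1 - lambda = 1 / (1 + beta eps / D) and
    lambda D = (1 - lambda) beta eps.  The first identity turns the hypothesis
    on gamma into q < 1, although T itself may be expansive.  By the second,
    the residual is at most (1 - lambda) eps <= eps as soon as
    q^k r0 <= (1 - beta) eps; taking logarithms, this is what the iteration
    count guarantees ([iter_count_contraction]). *)

(** The count is long enough for the geometric factor to bring the initial
    residual r0 below (1 - beta) eps, degenerate cases included: if gamma = 0
    the factor vanishes from the first iteration on. *)
Lemma iter_count_contraction (R : realType) (gamma lambda beta eps r0 : R)
    (k : nat) :
  0 <= gamma -> 0 < 1 - lambda -> (1 - lambda) * gamma < 1 ->
  0 < (1 - beta) * eps -> 0 <= r0 ->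
  (iter_count gamma lambda beta eps r0 <= k)%N ->
  ((1 - lambda) * gamma) ^+ k * r0 <= (1 - beta) * eps.
Proof.
set q := (1 - lambda) * gamma; set c := (1 - beta) * eps.
move=> gamma_ge0 lambda_lt1 q_lt1 c_gt0 r0_ge0; rewrite /iter_count -/q -/c.
case: eqVneq => [gamma0 k_gt0|gamma_neq0].
  by rewrite /q gamma0 mulr0 expr0n eqn0Ngt k_gt0 mul0r ltW.
case: eqVneq => [-> _|r0_neq0 count_le]; first by rewrite mulr0 ltW.
have q_gt0 : 0 < q by rewrite mulr_gt0// lt_neqAle eq_sym gamma_neq0.
have r0_gt0 : 0 < r0 by rewrite lt_neqAle eq_sym r0_neq0.
have lnq_gt0 : 0 < - ln q by rewrite oppr_gt0 ln_lt0// q_gt0.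
(* The truncation at 0 only increases the count. *)
have : ln (r0 / c) / - ln q <= k%:R.
  apply: le_trans (ceil_ge _) _; rewrite -[k%:R]/(k%:Z%:~R) ler_int.
  move: count_le; rewrite -lez_nat gez0_abs ?le_max ?lexx//.
  by apply: le_trans; rewrite le_max lexx orbT.
rewrite ler_pdivrMr// mulrN => ln_le.
rewrite -ler_pdivlMr// -ler_ln ?posrE ?exprn_gt0 ?divr_gt0// lnXn//.
rewrite -[c / r0]invf_div lnV ?posrE ?divr_gt0//.
by rewrite -mulr_natl; lra.
Qed.

Section AnchoredIteration.
Variables (R : realType) (E : normedModType R) (C : set E) (D : R).
Variables (T : E -> E) (gamma lambda : R) (x0 : E).
Hypothesis C_convex : convex_set C.
Hypothesis C_diam : forall u v, C u -> C v -> `|u - v| <= D.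
Hypothesis T_self : set_fun C C T.
Hypothesis T_lip : gamma.-lipschitz_C T.
Hypothesis gamma_ge0 : 0 <= gamma.
Hypothesis lambda_ge0 : 0 <= lambda.
Hypothesis lambda_le1 : lambda <= 1.
Hypothesis x0C : C x0.

Let x := anchored_iter T lambda x0.
(* The contraction factor of the iteration map u |-> lambda x0 + (1 - lambda) T u. *)
Let q := (1 - lambda) * gamma.

(** Each iterate is a convex combination of x0 and a point of T(C). *)
Lemma anchored_iter_mem k : C (x k).
Proof.
elim: k => [//|k xkC].
have /= := C_convex (Itv01 lambda_ge0 lambda_le1) (mem_set x0C)
  (mem_set (T_self xkC)).
by rewrite inE.
Qed.

Let lipC u v : C u -> C v -> `|T u - T v| <= gamma * `|u - v|.
Proof. by move=> uC vC; exact: (@T_lip (u, v) (conj uC vC)). Qed.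

Lemma anchored_iter_step k :
  `|x k.+1 - x k| <= (1 - lambda) * (q ^+ k * `|T x0 - x0|).
Proof.
have l1 : 0 <= 1 - lambda by rewrite subr_ge0.
elim: k => [|k IHk].
  rewrite expr0 mul1r -[X in X * _]ger0_norm// -normrZ.
  by rewrite /= scalerBr [X in _ <= `|_ - X|]scalerBl scale1r opprB addrCA addrA.
have -> : x k.+2 - x k.+1 = (1 - lambda) *: (T (x k.+1) - T (x k)).
  by rewrite /= scalerBr opprD addrACA subrr add0r.
rewrite normrZ ger0_norm// ler_wpM2l//.
apply: le_trans (lipC (anchored_iter_mem _) (anchored_iter_mem _)) _.
apply: le_trans (ler_wpM2l gamma_ge0 IHk) _.
by rewrite exprS /q le_eqVlt; apply/orP; left; apply/eqP; ring.
Qed.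

Lemma anchored_iter_residual k :
  `|T (x k) - x k| <= lambda * D + (1 - lambda) * (q ^+ k * `|T x0 - x0|).
Proof.
have l1 : 0 <= 1 - lambda by rewrite subr_ge0.
case: k => [|k].
  (* At k = 0 the two sides differ only in bounding lambda r0 by lambda D. *)
  rewrite expr0 mul1r -[leLHS]mul1r -{1}(subrKC lambda 1) mulrDl.
  by rewrite lerD2r ler_wpM2l// C_diam//; exact: T_self.
have -> : T (x k.+1) - x k.+1 =
    lambda *: (T (x k.+1) - x0) + (1 - lambda) *: (T (x k.+1) - T (x k)).
  by rewrite !scalerBr addrACA -scalerDl subrKC scale1r -opprD.
apply: le_trans (ler_normD _ _) _; rewrite !normrZ !ger0_norm//.
apply: lerD; rewrite ler_wpM2l//.
  by apply: C_diam => //; apply: T_self; exact: anchored_iter_mem.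
apply: le_trans (lipC (anchored_iter_mem _) (anchored_iter_mem _)) _.
apply: le_trans (ler_wpM2l gamma_ge0 (anchored_iter_step k)) _.
by rewrite exprS /q le_eqVlt; apply/orP; left; apply/eqP; ring.
Qed.

End AnchoredIteration.

Theorem lemma2 (R : realType) (E : normedModType R) (C : set E) (D : R)
    (T : E -> E) (gamma eps beta : R) (x0 : E)
    (C_bounded : bounded_set C) (C_convex : convex_set C)
    (C_diam : (ereal_sup [set `|x - y|%:E | x in C & y in C] <= D%:E)%E)
    (D_gt0 : 0 < D)
    (T_self : set_fun C C T)
    (T_lip : gamma.-lipschitz_C T)
    (eps_gt0 : 0 < eps)
    (beta_gt0 : 0 < beta) (beta_lt1 : beta < 1)
    (x0C : C x0)
    (gamma_ge0 : 0 <= gamma) (gamma_lt : gamma < 1 + beta * eps / D) :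
  let lambda := anchor_weight beta eps D in
  let x := anchored_iter T lambda x0 in
  forall k : nat,
    (iter_count gamma lambda beta eps `|T x0 - x0|%R <= k)%N ->
    `|T (x k) - x k| <= eps.
Proof.
move=> lambda x k count_le.
have a_gt0 : 0 < beta * eps / D by rewrite divr_gt0 ?mulr_gt0.
have a1_gt0 : 0 < 1 + beta * eps / D by rewrite addr_gt0.
have lambdaC : 1 - lambda = (1 + beta * eps / D)^-1.
  rewrite /lambda /anchor_weight -[X in X - _](divff (lt0r_neq0 a1_gt0)).
  by rewrite -mulrBl addrK mul1r.
have lambdaD : lambda * D = (1 - lambda) * (beta * eps).
  by rewrite lambdaC /lambda /anchor_weight mulrAC divfK ?gt_eqF// mulrC.
have lambda_gt0 : 0 < lambda by rewrite divr_gt0.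
have lambda_lt1 : 0 < 1 - lambda by rewrite lambdaC invr_gt0.
have q_lt1 : (1 - lambda) * gamma < 1.
  by rewrite lambdaC mulrC ltr_pdivrMr// mul1r.
have diam u v : C u -> C v -> `|u - v| <= D.
  move=> uC vC; rewrite -lee_fin; apply: le_trans C_diam.
  by apply: ereal_sup_ubound; exists u => //; exists v.
have lambda_le1 : lambda <= 1 by rewrite -subr_ge0 ltW.
apply: le_trans (anchored_iter_residual C_convex diam T_self T_lip gamma_ge0
  (ltW lambda_gt0) lambda_le1 x0C k) _.
have c_gt0 : 0 < (1 - beta) * eps by rewrite mulr_gt0// subr_gt0.
have /(ler_wpM2l (ltW lambda_lt1)) qk_le := iter_count_contraction gamma_ge0
  lambda_lt1 q_lt1 c_gt0 (normr_ge0 _) count_le.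
rewrite lambdaD; apply: le_trans (lerD (lexx _) qk_le) _.
rewrite -mulrDr -mulrDl subrKC mul1r ler_piMl ?(ltW eps_gt0)//.
by rewrite gerBl ltW.
Qed.
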